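(* Let $C\subset\mathbb{R}^2$ be a circle, let $a,b\in C$ be diametrically opposite points, let $U$ be an arbitrary neighborhood of $\{a,b\}$, and let $E=C\setminus U$. Then $E$ can be moved continuously to any other position in the plane in arbitrarily small area; that is, for every $g\in \mathrm{Isom}^+(\mathbb{R}^2)$ and every $\varepsilon>0$ there is a continuous map $\gamma:[0,1]\to\mathrm{Isom}^+(\mathbb{R}^2)$ with $\gamma(0)=\mathrm{id}$, $\gamma(1)=g$, and $$\Big|\bigcup_{t\in[0,1]}\gamma(t)(E)\Big|<\varepsilon .$$
   Context: $\mathrm{Isom}^+(\mathbb{R}^2)$ is the group of orientation-preserving isometries of $\mathbb{R}^2$ with its usual topology; $|\cdot|$ is Lebesgue measure on $\mathbb{R}^2$. *)

(* Defs.v *)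
From HB Require Import structures.
From mathcomp Require Import all_boot all_order all_algebra.
From mathcomp Require Import all_classical all_reals all_analysis.

Set Implicit Arguments.
Unset Strict Implicit.
Unset Printing Implicit Defensive.

Import Order.TTheory GRing.Theory Num.Theory.
Import numFieldNormedType.Exports.

Local Open Scope classical_set_scope.
Local Open Scope ring_scope.

Notation plane R := (R * R)%type.

(* The norm that the library puts on a product is the sup norm; it induces the
   usual topology, but metric notions need the Euclidean distance. *)
Definition edist (R : realType) (p q : plane R) : R :=
  Num.sqrt ((p.1 - q.1) ^+ 2 + (p.2 - q.2) ^+ 2).

Definition circle (R : realType) (c : plane R) (r : R) : set (plane R) :=
  [set p | edist c p = r].

Definition signed_area (R : realType) (u v : plane R) : R :=
  u.1 * v.2 - u.2 * v.1.

Definition isometry (R : realType) (f : plane R -> plane R) : Prop :=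
  forall p q, edist (f p) (f q) = edist p q.

Definition orientation_preserving (R : realType) (f : plane R -> plane R) :
    Prop :=
  forall p q s, 0 < signed_area (q - p) (s - p) ->
    0 < signed_area (f q - f p) (f s - f p).

(* As a subset of this function space, the group has the compact-open topology.
   Surjectivity is not required: isometries of the plane are bijective. *)
Definition isom_plus (R : realType) : set {compact-open, plane R -> plane R} :=
  [set f | isometry f /\ orientation_preserving f].

(* Outer measure of the Lebesgue measure of the plane: it is defined on all
   subsets and equals the (completed) measure on the measurable ones. *)
Definition area (R : realType) : set (plane R) -> \bar R :=
  mu_ext (@lebesgue_measure R \x @lebesgue_measure R)%E.

(* Main.v *)
Require Import Defs.
From mathcomp Require Import all_boot all_order all_algebra.
From mathcomp Require Import all_classical all_reals all_analysis.
From mathcomp Require Import ring lra zify.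
Import Order.TTheory GRing.Theory Num.Theory.
Import numFieldNormedType.Exports.
Local Open Scope classical_set_scope.
Local Open Scope ring_scope.

(** Rotating the circle about its centre moves it inside itself, so rotations
    are free, and the gap may point in any direction at any moment.  It remains
    to realize a translation of the centre by a polygonal line, each segment of
    which is labelled with the axis that the gap has there.

    Divide the directions, counted modulo [pi], into cells of a small angle [h].
    A cell is harmless for a segment in two cases.  Either it lies in the gap
    ([feasible_hidden]); or the segment is tangent to the circle at the cell, and
    then the cell sweeps an area [O(h ^+ 2)] per unit of length
    ([coverable_tangent_sweep]).  In the second case the bound persists when the
    segment is replaced by any path close enough to it, whatever its labels are
    ([coverable_fatten], [feasible_collapse]); so this cell needs no attention
    any more, and only the others have to be considered when the segment is
    refined.  Refining means zigzagging: a segment along [v + w] is replaced by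
    many short alternating segments along [v] and [w] ([feasible_add]).

    Consider an arc of cells that still need attention.  If the gap can hide it,
    nothing is left to do.  Otherwise write the given direction as a combination
    of the tangents at the two ends of the arc, which has bounded coefficients
    because the arc is neither very short nor close to a half-turn.  A motion
    along the tangent at one end disposes of the last cell there; after that it
    differs from the tangent at the new end by a correction of length [O(h)],
    whose cost is bounded by the costs already obtained for the shorter arc.  So
    the cost grows by a factor [1 + O(h)] per cell, hence by a bounded factor in
    all ([feasible_growth]), and each cell costs [O(h ^+ 2)].  The complete
    half-turn of directions is reduced to such arcs in the same way, starting
    from the two ends of a quarter-turn ([unif_feasible_full]).  Summing over the
    [O(1/h)] cells gives the total area [O(h)] ([small_translation]).

    Areas are estimated throughout by finite covers with squares.  The labelled
    polygonal line is finally turned into a continuous motion ([run], [moves]),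
    whose rotations about the vertices sweep finitely many circles only, and an
    orientation-preserving isometry is a rotation about the centre followed by a
    translation ([isom_plus_rigid]). *)

Set Implicit Arguments.
Unset Strict Implicit.
Unset Printing Implicit Defensive.

(** * Covers by finitely many squares *)

Section Covering.
Context {R : realType}.
Implicit Types (p q v : plane R) (X Y : set (plane R)) (e h : R).

(** Sup-norm distance, so that the points near [p] form an axis-parallel
    square, whose area is elementary. *)
Definition near_pt h p q := `|q.1 - p.1| <= h /\ `|q.2 - p.2| <= h.

(** An upper bound for the outer Jordan content.  Finite covers are enough here,
    and they can be translated, reflected and enlarged directly. *)
Definition coverable X e := exists s : seq (plane R * R),
  (forall q, X q -> exists2 b, b \in s & near_pt b.2 b.1 q)
  /\ \sum_(b <- s) (2 * b.2) ^+ 2 < e.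

Definition translate v X : set (plane R) := [set q | X (q - v)].

Lemma near_pt_trans h h' p q s :
  near_pt h p q -> near_pt h' q s -> near_pt (h + h') p s.
Proof.
rewrite /near_pt => -[a1 a2] [b1 b2]; split.
  by apply: le_trans (ler_distD q.1 _ _) _; rewrite addrC lerD.
by apply: le_trans (ler_distD q.2 _ _) _; rewrite addrC lerD.
Qed.

Lemma near_pt_translate h p q v : near_pt h p (q - v) -> near_pt h (p + v) q.
Proof.
rewrite /near_pt /= => -[a1 a2]; split; rewrite -?[_.1 - _]/(_ - _).
  by rewrite (_ : _ - _ = q.1 - v.1 - p.1) //; ring.
by rewrite (_ : _ - _ = q.2 - v.2 - p.2) //; ring.
Qed.

Lemma near_pt_le h h' p q : h <= h' -> near_pt h p q -> near_pt h' p q.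
Proof. by move=> hh' [a b]; split; apply: le_trans hh'. Qed.

Lemma coverable_sub X Y e : X `<=` Y -> coverable Y e -> coverable X e.
Proof. by move=> XY [s [sY se]]; exists s; split => // q /XY /sY. Qed.

Lemma coverable_le X e e' : e <= e' -> coverable X e -> coverable X e'.
Proof. by move=> ee' [s [sX se]]; exists s; split => //; apply: lt_le_trans ee'. Qed.

Lemma coverable0 e : 0 < e -> coverable set0 e.
Proof. by move=> e0; exists [::]; split => //; rewrite big_nil. Qed.

Lemma coverableU X Y e e' :
  coverable X e -> coverable Y e' -> coverable (X `|` Y) (e + e').
Proof.
move=> [s [sX se]] [s' [sY se']]; exists (s ++ s'); split.
  by move=> q [/sX|/sY] [b bs qb]; exists b => //; rewrite mem_cat bs ?orbT.
by rewrite big_cat /= ltrD.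
Qed.

Lemma coverable_bigU (X : nat -> set (plane R)) N e :
  (forall i, (i < N.+1)%N -> coverable (X i) e) ->
  coverable (\bigcup_(i in [set i | (i < N.+1)%N]) X i) (N.+1%:R * e).
Proof.
elim: N => [|N IH] hX.
  rewrite mul1r; apply: coverable_sub (hX 0%N isT) => q [i].
  by rewrite /= ltnS leqn0 => /eqP ->.
rewrite -[N.+2]addn1 natrD mulrDl mul1r.
apply: coverable_sub (coverableU (IH _) (hX N.+1 _)) => //; last first.
  by move=> i iN; apply: hX; exact: ltnW.
move=> q [i /=]; rewrite addn1 ltnS leq_eqVlt => /orP[/eqP->|iN] Xq; first by right.
by left; exists i.
Qed.

Lemma coverable_translate v X e : coverable X e -> coverable (translate v X) e.
Proof.
move=> [s [sX se]]; exists [seq (b.1 + v, b.2) | b <- s]; split.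
  move=> q /sX [b bs qb]; exists (b.1 + v, b.2); first by apply/mapP; exists b.
  exact: near_pt_translate.
by rewrite big_map.
Qed.

Lemma coverable_opp X e : coverable X e -> coverable [set q | X (- q)] e.
Proof.
move=> [s [sX se]]; exists [seq (- b.1, b.2) | b <- s]; split.
  move=> q /sX [b bs [q1 q2]]; exists (- b.1, b.2); first by apply/mapP; exists b.
  by split => /=; rewrite opprK -normrN opprD.
by rewrite big_map.
Qed.

(** Only finitely many squares are involved, so a strict bound on their total
    area survives a small common enlargement. *)
Lemma coverable_fatten X e : coverable X e ->
  exists2 t, 0 < t & coverable [set q | exists2 p, X p & near_pt t p q] e.
Proof.
move=> [s [sX]]; set S := \sum_(b <- s) _ => Se.
pose K := \sum_(b <- s) (8 * `|b.2| + 4).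
have K0 : 0 <= K by apply: sumr_ge0 => b _; have := normr_ge0 b.2; lra.
pose t := Num.min 1 ((e - S) / (K + 1)).
have t0 : 0 < t by rewrite lt_min ltr01 divr_gt0 // ?subr_gt0 //; lra.
have t1 : t <= 1 by rewrite ge_min lexx.
have tK : t * K < e - S.
  have : t * (K + 1) <= e - S.
    by rewrite -ler_pdivlMr ?ge_min ?lexx ?orbT //; lra.
  by nra.
exists t => //; exists [seq (b.1, `|b.2| + t) | b <- s]; split.
  move=> q [p /sX [b bs pb] pq]; exists (b.1, `|b.2| + t).
    by apply/mapP; exists b.
  by apply: near_pt_trans pq => /=; apply: near_pt_le pb; exact: ler_norm.
rewrite big_map /=.
suff : \sum_(b <- s) (2 * (`|b.2| + t)) ^+ 2 <= S + t * K by lra.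
rewrite mulr_sumr -big_split /=; apply: ler_sum => b _.
have -> : (2 * b.2) ^+ 2 = (2 * `|b.2|) ^+ 2 by rewrite !exprMn real_normK ?num_real.
by have := normr_ge0 b.2; nra.
Qed.

(** A tilted [a * b] box with [b <= a] is cut across its long side into pieces
    of diameter comparable to [b]; the loss is a constant factor only. *)
Lemma coverable_box (p w : plane R) (x a y b e : R) :
  near_pt 1 0 p -> near_pt 1 0 w -> 0 < b -> b <= a -> 32 * a * b < e ->
  coverable [set q | exists s t, [/\ x <= s <= x + a, y <= t <= y + b
                                   & q = s *: p + t *: w]] e.
Proof.
move=> [p1 p2] [w1 w2] b0 ba abe; rewrite /= !subr0 in p1 p2 w1 w2.
pose N := (Num.truncn (a / b)).+1.
have ab0 : 0 <= a / b by rewrite divr_ge0 ?ltW // (lt_le_trans b0).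
have Nab : N%:R <= a / b + 1 by rewrite /N -natr1 lerD2r; case/andP: (truncn_itv ab0).
exists [seq ((x + i%:R * b) *: p + y *: w, 2 * b) | i <- iota 0 N]; split; last first.
  rewrite big_map (eq_bigr (fun=> (2 * (2 * b)) ^+ 2)) //.
  rewrite big_const_seq count_predT size_iota iter_addr addr0.
  rewrite -[X in X < _]mulr_natr; apply: le_lt_trans abe.
  have : (2 * (2 * b)) ^+ 2 * N%:R <= (2 * (2 * b)) ^+ 2 * (a / b + 1).
    by rewrite ler_wpM2l ?sqr_ge0.
  move/le_trans; apply.
  have -> : (2 * (2 * b)) ^+ 2 * (a / b + 1) = 16 * a * b + 16 * b * b.
    by field; lra.
  by nra.
move=> q [s [t [/andP[xs sa] /andP[yt tb] ->]]].
pose i := Num.truncn ((s - x) / b).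
have sx0 : 0 <= (s - x) / b by rewrite divr_ge0 ?subr_ge0 // ltW.
have /andP[i1 i2] := truncn_itv sx0.
rewrite ler_pdivlMr // in i1; rewrite ltr_pdivrMr // -natr1 in i2.
exists ((x + i%:R * b) *: p + y *: w, 2 * b).
  apply/mapP; exists i => //; rewrite mem_iota add0n ltnS /=.
  by apply: le_truncn; rewrite ler_pM2r ?invr_gt0 //; lra.
have key (u u' : R) : `|u| <= 1 -> `|u'| <= 1 ->
    `|s * u + t * u' - ((x + i%:R * b) * u + y * u')| <= 2 * b.
  move=> u1 u2.
  have -> : s * u + t * u' - ((x + i%:R * b) * u + y * u') =
    (s - x - i%:R * b) * u + (t - y) * u' by ring.
  apply: le_trans (ler_normD _ _) _; rewrite !normrM.
  have h1 : `|s - x - i%:R * b| <= b by rewrite ler_norml; apply/andP; split; lra.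
  have h2 : `|t - y| <= b by rewrite ler_norml; apply/andP; split; lra.
  have := ler_pM (normr_ge0 _) (normr_ge0 _) h1 u1.
  have := ler_pM (normr_ge0 _) (normr_ge0 _) h2 u2.
  by lra.
by split; exact: key.
Qed.

End Covering.

(** * Directions and tangential sweeps *)

Section Directions.
Context {R : realType}.
Implicit Types (x y s t : R).

Definition dir x : plane R := (cos x, sin x).
Definition tang x : plane R := (- sin x, cos x).

Lemma sin_le_id x : 0 <= x -> sin x <= x.
Proof.
move=> x0.
have [c _] := @MVT_segment R sin cos 0 x x0 (fun y _ => is_derive_sin y)
  (continuous_subspaceT (@continuous_sin R)).
by rewrite sin0 !subr0 => ->; rewrite -[leRHS]mul1r ler_wpM2r // cos_le1.
Qed.

Lemma norm_sin_le x : `|sin x| <= `|x|.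
Proof.
wlog x0 : x / 0 <= x.
  move=> h; case: (leP 0 x) => x0; first exact: h.
  by rewrite -(normrN x) -(normrN (sin x)) -sinN h // oppr_ge0 ltW.
rewrite (ger0_norm x0).
have [x1|x1] := leP x 1; last by apply: le_trans (sin_max x) (ltW x1).
rewrite ger0_norm ?sin_le_id //; apply: sin_ge0_pi; rewrite x0 /=.
by have := pi_ge2 R; lra.
Qed.

Lemma sinB_half x y : sin x - sin y = 2 * cos ((x + y) / 2) * sin ((x - y) / 2).
Proof.
set u := (x + y) / 2; set v := (x - y) / 2.
have -> : x = u + v by rewrite /u /v; field.
have -> : y = u - v by rewrite /u /v; field.
by rewrite sinD sinB; ring.
Qed.

Lemma cosB_half x y : cos x - cos y = - (2 * sin ((x + y) / 2) * sin ((x - y) / 2)).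
Proof.
set u := (x + y) / 2; set v := (x - y) / 2.
have -> : x = u + v by rewrite /u /v; field.
have -> : y = u - v by rewrite /u /v; field.
by rewrite cosD cosB; ring.
Qed.

Lemma sin_lip x y : `|sin x - sin y| <= `|x - y|.
Proof.
rewrite sinB_half !normrM (ger0_norm (ler0n _ 2)).
have h := norm_sin_le ((x - y) / 2).
rewrite normrM (_ : `|2^-1| = 2^-1) in h; last by rewrite ger0_norm.
have := ler_pM (normr_ge0 _) (normr_ge0 _) (cos_max ((x + y) / 2)) h.
lra.
Qed.

Lemma cos_lip x y : `|cos x - cos y| <= `|x - y|.
Proof.
have := sin_lip (x + pi / 2) (y + pi / 2).
by rewrite !sinDpihalf (_ : x + pi / 2 - (y + pi / 2) = x - y) //; ring.
Qed.

(** Near its maximum the cosine is flat: over angles of size at most [h] its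
    Lipschitz constant is [h].  This is the gain of moving tangentially. *)
Lemma cos_lip_small x y h : `|x| <= h -> `|y| <= h ->
  `|cos x - cos y| <= h * `|x - y|.
Proof.
move=> xh yh; rewrite cosB_half normrN !normrM (ger0_norm (ler0n _ 2)).
have h1 := norm_sin_le ((x - y) / 2); have h2 := norm_sin_le ((x + y) / 2).
rewrite normrM (_ : `|2^-1| = 2^-1) in h1; last by rewrite ger0_norm.
rewrite normrM (_ : `|2^-1| = 2^-1) in h2; last by rewrite ger0_norm.
have h3 := ler_normD x y.
have h4 : `|sin ((x + y) / 2)| <= h by lra.
have := ler_pM (normr_ge0 _) (normr_ge0 _) h4 h1.
lra.
Qed.

Lemma dir_tang x y :
  dir x = sin (x - y) *: tang y + cos (x - y) *: dir y.
Proof.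
have [e1 e2] : cos x = cos (x - y + y) /\ sin x = sin (x - y + y).
  by rewrite subrK.
by rewrite {1}/dir e1 e2 cosD (sinD (x - y)); congr pair;
  rewrite /= /GRing.scale /=; ring.
Qed.

Lemma near1_dir x : near_pt 1 0 (dir x).
Proof. by split; rewrite subr0; [exact: cos_max|exact: sin_max]. Qed.

Lemma near1_tang x : near_pt 1 0 (tang x).
Proof. by split; rewrite subr0 ?normrN; [exact: sin_max|exact: cos_max]. Qed.

(** The swept area is the length of the motion times the width of the arc seen
    along the motion; the arc is cut finely enough for its own length not to
    matter. *)
Lemma coverable_tangent_sweep (r l h x y : R) :
  0 < r -> 0 < l -> 0 < h -> h <= 1 -> x <= y <= x + h ->
  coverable [set q | exists t z, [/\ 0 <= t <= 1, x <= z <= x + h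
     & q = t *: (l *: tang y) + r *: dir z]] (l * (200 * r * h ^+ 2)).
Proof.
move=> r0 l0 h0 h1 /andP[xy yx].
pose N := Num.truncn (r * h / l).
have /andP[_ Nl] : N%:R <= r * h / l < N.+1%:R.
  by apply: truncn_itv; rewrite divr_ge0 ?mulr_ge0 ?ltW.
have N0 : 0 < N.+1%:R :> R by rewrite ltr0n.
set d := h / N.+1%:R.
have d0 : 0 < d by rewrite divr_gt0.
have rdl : r * d <= l.
  have : r * h < N.+1%:R * l by rewrite -ltr_pdivrMr.
  by rewrite /d mulrA ler_pdivrMr //; lra.
have dh : d <= h by rewrite /d ler_pdivrMr // ler_peMr ?(ltW h0) // ler1n.
have -> : l * (200 * r * h ^+ 2) = N.+1%:R * (200 * r * h * d * l).
  by rewrite /d; field; rewrite gt_eqF.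
pose X (i : nat) : set (plane R) := [set q | exists s t,
  [/\ r * sin (x + i%:R * d - y) - r * d <= s
        <= r * sin (x + i%:R * d - y) - r * d + (l + 2 * r * d),
      r * cos (x + i%:R * d - y) - r * h * d <= t
        <= r * cos (x + i%:R * d - y) - r * h * d + 2 * r * h * d
    & q = s *: tang y + t *: dir y]].
apply: (@coverable_sub _ _ (\bigcup_(i in [set i | (i < N.+1)%N]) X i)).
  move=> q [t [z [/andP[t0 t1] /andP[xz zx] ->]]].
  pose i := minn N (Num.truncn ((z - x) / d)).
  have zxd : 0 <= (z - x) / d by rewrite divr_ge0 ?subr_ge0 // ltW.
  have /andP[i1 i2] := truncn_itv zxd.
  rewrite ler_pdivlMr // in i1; rewrite ltr_pdivrMr // -natr1 in i2.
  have hN : h = (N%:R + 1) * d by rewrite natr1 /d mulrC divfK ?gt_eqF.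
  have iz : x + i%:R * d <= z <= x + i%:R * d + d.
    rewrite /i; case: (leqP N (Num.truncn ((z - x) / d))) => hi; last first.
      by apply/andP; split; lra.
    have : N%:R * d <= (Num.truncn ((z - x) / d))%:R * d.
      by rewrite ler_pM2r // ler_nat.
    by move=> ?; apply/andP; split; lra.
  have ix : 0 <= i%:R * d by rewrite mulr_ge0 ?(ltW d0).
  exists i; first by rewrite /= ltnS geq_minl.
  exists (t * l + r * sin (z - y)), (r * cos (z - y)).
  set w := x + i%:R * d in iz *.
  case/andP: iz => wz zw; have xw : x <= w by rewrite lerDl.
  have zwd : `|z - y - (w - y)| <= d by rewrite ler_norml; apply/andP; split; lra.
  have hs : `|sin (z - y) - sin (w - y)| <= d by apply: le_trans (sin_lip _ _) zwd.
  have hc : `|cos (z - y) - cos (w - y)| <= h * d.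
    apply: le_trans (cos_lip_small (h := h) _ _) _; last by rewrite ler_wpM2l ?(ltW h0).
      by rewrite ler_norml; apply/andP; split; lra.
    by rewrite ler_norml; apply/andP; split; lra.
  move: hs hc; rewrite !ler_norml => /andP[s1 s2] /andP[c1 c2].
  split; last first.
  - rewrite (dir_tang z y) scalerDr !scalerA addrA -scalerDl; congr (_ *: _ + _).
  - by apply/andP; split; nra.
  - have ? : 0 <= t * l by rewrite mulr_ge0 // ltW.
    have ? : t * l <= l by rewrite ler_piMl // ltW.
    by apply/andP; split; nra.
apply: coverable_bigU => i _; apply: coverable_box.
- exact: near1_tang.
- exact: near1_dir.
- by rewrite !mulr_gt0.
- suff : r * d * h <= r * d * 1 by lra.
  by rewrite ler_wpM2l // mulr_ge0 // ltW.
- have : (r * d) * (r * h * d) <= l * (r * h * d).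
    by rewrite ler_wpM2r // !mulr_ge0 // ltW.
  have : 0 < l * (r * h * d) by rewrite !mulr_gt0.
  lra.
Qed.

End Directions.

(** * Labelled itineraries *)

Section Itineraries.
Context {R : realType}.
Implicit Types (l : seq (plane R * R)) (D : R -> set (plane R)) (v q z : plane R).

(** An itinerary of the centre of the circle is a list of displacements, each
    with a label: the direction of the axis of the gap during the displacement. *)
Fixpoint endpoint l : plane R := if l is m :: l' then m.1 + endpoint l' else 0.

(** [D a] is the set that is carried along while the label is [a]. *)
Fixpoint sweep D l : set (plane R) :=
  if l is m :: l' then
    [set q | exists t z, [/\ 0 <= t <= 1, D m.2 z & q = t *: m.1 + z]]
    `|` translate m.1 (sweep D l')
  else set0.

(** Carrying the origin along gives the polygonal line itself. *)
Definition track := sweep (fun=> [set 0]).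

Definition repeat_path n l := iter n (cat l) [::].

Definition opp_path l := [seq (- m.1, m.2) | m <- l].

Lemma endpoint_cat l l' : endpoint (l ++ l') = endpoint l + endpoint l'.
Proof. by elim: l => [|m l IH] /=; rewrite ?add0r // IH addrA. Qed.

Lemma endpoint_repeat n l : endpoint (repeat_path n l) = n%:R *: endpoint l.
Proof.
elim: n => [|n IH]; first by rewrite scale0r.
by rewrite /= endpoint_cat IH -natr1 scalerDl scale1r addrC.
Qed.

Lemma endpoint_opp l : endpoint (opp_path l) = - endpoint l.
Proof. by elim: l => [|m l IH] /=; rewrite ?oppr0 // IH opprD. Qed.

Lemma sweep_cat D l l' :
  sweep D (l ++ l') `<=` sweep D l `|` translate (endpoint l) (sweep D l').
Proof.
elim: l => [|m l IH] q /=; first by right; rewrite /translate /= subr0.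
case=> [|/IH [] h]; first by left; left.
  by left; right.
by right; rewrite /translate /= opprD addrA.
Qed.

Lemma sweep_repeat D l n : sweep D (repeat_path n l) `<=`
  \bigcup_(i in [set i | (i < n)%N]) translate (i%:R *: endpoint l) (sweep D l).
Proof.
elim: n => [//|n IH] q /= /sweep_cat [h|/IH [i /= ilt h]].
  by exists 0%N => //; rewrite /translate /= scale0r subr0.
exists i.+1 => //; move: h; rewrite /translate /= -natr1 scalerDl scale1r.
by rewrite opprD addrA addrAC.
Qed.

Lemma sweep_opp D l : (forall a z, D a z -> D a (- z)) ->
  forall q, sweep D (opp_path l) q -> sweep D l (- q).
Proof.
move=> Dopp; elim: l => [//|m l IH] q /= [[t [z [t01 Dz ->]]]|/IH h].
  by left; exists t, (- z); split; [|exact: Dopp|rewrite scalerN opprD opprK].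
by right; rewrite /translate /= -[_ - _]opprK; move: h; rewrite opprD !opprK addrC.
Qed.

Lemma sweep_track D l q : sweep D l q ->
  exists c a z, [/\ track l c, D a z & q = c + z].
Proof.
elim: l q => [//|m l IH] q /= [[t [z [t01 Dz ->]]]|/IH [c [a [z [hc Dz e]]]]].
  exists (t *: m.1), m.2, z; split => //; left.
  by exists t, 0; rewrite addr0.
exists (m.1 + c), a, z; split => //; last by rewrite -addrA -e addrC subrK.
by right; rewrite /translate /= addrC addKr.
Qed.

End Itineraries.

Section Feasible.
Context {R : realType}.
Variables (r kappa h : R).
Hypotheses (r0 : 0 < r) (h0 : 0 < h) (h1 : h <= 1).
Implicit Types (B : set nat) (v w : plane R) (e : R).

(** The covering cost, per unit of length, of moving one cell tangentially; the
    quadratic dependence on [h] makes the sum over the [O(1/h)] cells small. *)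
Definition cell_cost : R := 400 * r * h ^+ 2.

Lemma cell_cost_gt0 : 0 < cell_cost.
Proof. exact: mulr_gt0 (mulr_gt0 (ltr0Sn _ _) r0) (exprn_gt0 _ h0). Qed.

(** The points at distance at least [kappa] from the axis of the gap. *)
Definition visible (z : plane R) (a : R) :=
  kappa <= `|z.1 * sin a - z.2 * cos a|.

(** Opposite arcs go together, because a gap and its opposite one have the same
    axis; hence the directions are counted modulo [pi]. *)
Definition cell (k : nat) : set (plane R) :=
  [set z | exists2 x, k%:R * h <= x <= k%:R * h + h
                      & z = r *: dir x \/ z = - (r *: dir x)].

Definition visible_part (X : set (plane R)) (a : R) :=
  [set z | X z /\ visible z a].

(** The cells of [B] can be carried in direction [v] at cost [e] per unit of
    motion.  All lengths [s] are required at once so that the notion is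
    homogeneous, and the itinerary must stay as close to the segment as one
    wishes so that it can replace this segment without spoiling the estimates
    that hold near it. *)
Definition feasible B v e := forall s t, 0 < s -> 0 < t -> exists l,
  [/\ endpoint l = s *: v,
      forall q, track l q ->
        exists2 u, 0 <= u <= 1 & near_pt t (u *: (s *: v)) q
    & forall k, B k -> coverable (sweep (visible_part (cell k)) l) (s * e)].

Lemma cell_opp k z : cell k z -> cell k (- z).
Proof.
move=> [x kx [->|->]]; exists x => //; first by right.
by left; rewrite opprK.
Qed.

Lemma visible_part_opp k a z :
  visible_part (cell k) a z -> visible_part (cell k) a (- z).
Proof.
case=> /cell_opp ? h2; split=> //; move: h2; rewrite /visible /=.
by rewrite -normrN opprB !mulNr opprK addrC.
Qed.

Lemma sweep_subset (D D' : R -> set (plane R)) l :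
  (forall a, D a `<=` D' a) -> sweep D l `<=` sweep D' l.
Proof.
move=> DD'; elim: l => [//|m l IH] q /= [[t [z [t01 /DD' Dz ->]]]|/IH]; last by right.
by left; exists t, z.
Qed.

Lemma feasible_sub B B' v e e' : e <= e' ->
  (forall k, B k -> exists2 k', B' k' & cell k `<=` cell k') ->
  feasible B' v e -> feasible B v e'.
Proof.
move=> ee' BB' F s t s0 t0; have [l [l1 l2 l3]] := F s t s0 t0.
exists l; split => // k /BB' [k' /l3 c kk'].
apply: coverable_le (_ : s * e <= _) _; first by rewrite ler_pM2l.
apply: coverable_sub c; apply: sweep_subset => a z [cz vz]; split => //.
exact: kk'.
Qed.

Lemma feasible_le B v e e' : e <= e' -> feasible B v e -> feasible B v e'.
Proof. by move=> ee'; apply: feasible_sub => // k Bk; exists k. Qed.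

Lemma feasible_zero B e : 0 < e -> feasible B 0 e.
Proof.
move=> e0 s t s0 t0; exists [::]; split => [||k _]; rewrite ?scaler0 //.
by apply: coverable0; rewrite mulr_gt0.
Qed.

Lemma feasible_opp B v e : feasible B v e -> feasible B (- v) e.
Proof.
move=> F s t s0 t0; have [l [l1 l2 l3]] := F s t s0 t0.
exists (opp_path l); split.
- by rewrite endpoint_opp l1 scalerN.
- move=> q /sweep_opp h2.
  have /l2 [u u01 [n1 n2]] : track l (- q).
    by apply: h2 => a z /= ->; rewrite oppr0.
  exists u => //; split; rewrite -normrN.
    by rewrite (_ : - _ = (- q).1 - (u *: (s *: v)).1) //= /GRing.scale /=; ring.
  by rewrite (_ : - _ = (- q).2 - (u *: (s *: v)).2) //= /GRing.scale /=; ring.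
move=> k /l3 /coverable_opp; apply: coverable_sub => q.
by apply: sweep_opp => a z; exact: visible_part_opp.
Qed.

Lemma feasible_scale B v e a b :
  `|a| <= b -> 0 < b -> 0 < e -> feasible B v e -> feasible B (a *: v) (b * e).
Proof.
move=> ab b0 e0 F.
wlog a0 : a ab / 0 <= a => [hw|].
  case: (lerP 0 a) => a0; first exact: hw.
  rewrite -[a]opprK scaleNr; apply: feasible_opp; apply: hw.
    by rewrite normrN.
  by rewrite oppr_ge0 ltW.
move: a0; rewrite le_eqVlt => /predU1P[<-|a0].
  by rewrite scale0r; apply: feasible_zero; rewrite mulr_gt0.
rewrite gtr0_norm // in ab.
apply: (@feasible_le _ _ (a * e)); first by rewrite ler_pM2r.
move=> s t s0 t0; have [l [l1 l2 l3]] := F (s * a) t (mulr_gt0 s0 a0) t0.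
exists l; split; first by rewrite l1 scalerA.
  by move=> q /l2; rewrite !scalerA.
by move=> k /l3; rewrite -mulrA.
Qed.

(** A segment in direction [v + w] is followed by a zigzag of many short
    excursions along [v] and [w]: it stays close to the segment, and the
    covered areas are proportional to the lengths. *)
Lemma feasible_add B v w e e' :
  feasible B v e -> feasible B w e' -> feasible B (v + w) (e + e').
Proof.
move=> F G s t s0 t0.
pose V := `|v.1| + `|v.2| + `|w.1| + `|w.2|.
have V0 : 0 <= V by rewrite !addr_ge0.
(* With [n.+1] zigzags each of them has diameter at most [t / 2]. *)
pose n := Num.truncn (2 * s * V / t).
have /andP[_ hn] : n%:R <= 2 * s * V / t < n.+1%:R.
  by apply: truncn_itv; rewrite divr_ge0 ?mulr_ge0 // ltW.
have n0 : 0 < n.+1%:R :> R by rewrite ltr0n.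
pose d := s / n.+1%:R.
have d0 : 0 < d by rewrite divr_gt0.
have dE : d = s / n.+1%:R by [].
have dV : d * V <= t / 2.
  move: hn; rewrite ltr_pdivrMr // => hn.
  by rewrite /d mulrAC ler_pdivrMr //; lra.
clearbody d.
have t20 : 0 < t / 2 by lra.
have [l1 [a1 b1 c1]] := F _ _ d0 t20.
have [l2 [a2 b2 c2]] := G _ _ d0 t20.
have tot : endpoint (l1 ++ l2) = d *: (v + w) by rewrite endpoint_cat a1 a2 scalerDr.
exists (repeat_path n.+1 (l1 ++ l2)); split.
- rewrite endpoint_repeat tot scalerA; congr (_ *: _).
  by rewrite dE mulrC divfK // gt_eqF.
- move=> q /sweep_repeat [i /= ilt]; rewrite tot {1}/translate /= => hq.
  have key (x y : R) : 0 <= x <= 1 -> 0 <= y <= 1 ->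
      near_pt (t / 2) 0 (x *: (d *: v) + y *: (d *: w)).
    move=> /andP[x0 x1] /andP[y0 y1].
    have aux (c c' : R) : `|c| + `|c'| <= V -> `|x * (d * c) + y * (d * c')| <= t / 2.
      move=> cV; apply: le_trans (ler_normD _ _) _.
      rewrite !normrM (ger0_norm x0) (ger0_norm y0) (gtr0_norm d0).
      have : x * (d * `|c|) <= 1 * (d * `|c|) by rewrite ler_wpM2r // mulr_ge0 // ltW.
      have : y * (d * `|c'|) <= 1 * (d * `|c'|) by rewrite ler_wpM2r // mulr_ge0 // ltW.
      have : d * (`|c| + `|c'|) <= d * V by rewrite ler_pM2l.
      lra.
    by split; rewrite subr0; apply: aux; rewrite /V;
      have := normr_ge0 v.1; have := normr_ge0 v.2; have := normr_ge0 w.1;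
      have := normr_ge0 w.2; lra.
  have e1 : (i%:R / n.+1%:R) *: (s *: (v + w)) = i%:R *: (d *: (v + w)).
    by rewrite !scalerA dE; congr (_ *: _); field; rewrite gt_eqF.
  exists (i%:R / n.+1%:R).
    by rewrite divr_ge0 //= ler_pdivrMr // mul1r ler_nat ltnW.
  rewrite e1; set c := i%:R *: _ in hq *.
  have fin (x y : R) : 0 <= x <= 1 -> 0 <= y <= 1 ->
      near_pt (t / 2) (x *: (d *: v) + y *: (d *: w)) (q - c) -> near_pt t c q.
    move=> x01 y01 /near_pt_translate.
    have /near_pt_trans h2 : near_pt (t / 2) c (x *: (d *: v) + y *: (d *: w) + c).
      by rewrite -{1}[c]add0r; apply: near_pt_translate; rewrite addrK; exact: key.
    by move/h2; rewrite -splitr.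
  case: (sweep_cat hq) => [/b1 [x x01 hx]|].
    by apply: (fin x 0) => //; rewrite ?lexx ?ler01 // scale0r addr0.
  rewrite /translate /= => /b2 [x x01 hx].
  apply: (fin 1 x) => //; rewrite ?lexx ?ler01 // scale1r addrC.
  by apply: near_pt_translate; rewrite -a1.
move=> k Bk.
have -> : s * (e + e') = n.+1%:R * (d * e + d * e').
  by rewrite dE; field; rewrite gt_eqF.
apply: coverable_sub (@sweep_repeat _ _ _ _) _.
apply: coverable_bigU => i _; apply: coverable_translate.
apply: coverable_sub (@sweep_cat _ _ _ _) _.
by apply: coverableU; [exact: c1|apply: coverable_translate; exact: c2].
Qed.

(** A gap that covers all of [B] makes the straight motion free; [e] has to be
    positive only because the bounds on areas are strict. *)
Lemma feasible_hidden B v a e : 0 < e ->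
  (forall k x, B k -> k%:R * h <= x <= k%:R * h + h -> r * `|sin (x - a)| < kappa) ->
  feasible B v e.
Proof.
move=> e0 hid s t s0 t0; exists [:: (s *: v, a)]; split => /=.
- by rewrite addr0.
- move=> q [[u [z [u01 /= -> ->]]]|//]; exists u => //; rewrite addr0.
  by split; rewrite subrr normr0 ltW.
move=> k Bk; apply: coverable_sub (@coverable0 R (s * e) _); last by rewrite mulr_gt0.
move=> q [[u [z [u01 [[x kx zx] vz] _]]]|//].
have := hid k x Bk kx; rewrite ltNge => /negP; apply.
apply: le_trans vz _.
rewrite sinB -(ger0_norm (ltW r0)) -normrM.
case: zx => -> /=; rewrite /GRing.scale /=; last by rewrite le_eqVlt; apply/orP; left;
  apply/eqP; congr (`|_|); ring.
by rewrite -normrN le_eqVlt; apply/orP; left; apply/eqP; congr (`|_|); ring.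
Qed.

(** Directions that are nearly perpendicular to the motion cost little, and
    the cost is then paid once and for all: it does not grow when the segment
    is replaced by any path that stays close enough to it. *)
Lemma feasible_collapse B k y e :
  k%:R * h <= y <= k%:R * h + h -> cell_cost <= e ->
  feasible (B `\ k) (tang y) e -> feasible B (tang y) e.
Proof.
move=> ky he F s t s0 t0.
have cov : coverable [set q | exists u z, [/\ 0 <= u <= 1, cell k z
    & q = u *: (s *: tang y) + z]] (s * e).
  apply: (@coverable_le _ _ (s * (200 * r * h ^+ 2) + s * (200 * r * h ^+ 2))).
    rewrite -mulrDr ler_pM2l //; apply: le_trans he.
    by rewrite /cell_cost; lra.
  have c1 := coverable_tangent_sweep r0 s0 h0 h1 ky.
  have c2 := coverable_translate (s *: tang y) (coverable_opp c1).
  apply: coverable_sub (coverableU c1 c2).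
  move=> q [u [z [u01 [x kx [->|->]] ->]]]; first by left; exists u, x.
  right; exists (1 - u), x; split => //.
    by case/andP: u01 => ? ?; apply/andP; split; lra.
  by rewrite scalerBl scale1r opprB opprB addrA addrAC.
(* The enlarged cover of the straight sweep serves every nearby itinerary. *)
have [t' t'0 cov'] := coverable_fatten cov.
have [|l [l1 l2 l3]] := F s (Num.min t t') s0; first by rewrite lt_min t0.
exists l; split => //.
  move=> q /l2 [u u01 hq]; exists u => //; apply: near_pt_le hq.
  by rewrite ge_min lexx.
move=> k' Bk'; have [e1|ne] := eqVneq k' k; last by apply: l3; split => //; apply/eqP.
apply: coverable_sub cov'; rewrite e1 => q /sweep_track [c [a [z [/l2 hc [cz _] ->]]]].
case: hc => u u01 hc; exists (u *: (s *: tang y) + z); first by exists u, z.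
apply: near_pt_translate; rewrite addrK; apply: near_pt_le hc.
by rewrite ge_min lexx orbT.
Qed.
End Feasible.

(** * Shortening an arc of directions *)

Section Growth.
Context {R : realType}.
Variables (r kappa h : R).
Hypotheses (r0 : 0 < r) (h0 : 0 < h) (h1 : h <= 1).
Implicit Types (B G : set nat) (v w : plane R) (e s A : R).

Local Notation feas := (feasible r kappa h).

Definition unif_feasible B A := forall v V, 0 < V -> `|v.1| + `|v.2| <= V ->
  feas B v (V * A).

Lemma unif_feasible_sub B B' A A' : A <= A' ->
  (forall k, B k -> exists2 k', B' k' & cell r h k `<=` cell r h k') ->
  unif_feasible B' A -> unif_feasible B A'.
Proof.
move=> AA' BB' F v V V0 vV; apply: feasible_sub (F v V V0 vV) => //.
by rewrite ler_pM2l.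
Qed.

Lemma unif_feasible_tang B A x : unif_feasible B A -> feas B (tang x) (2 * A).
Proof.
apply; first by [].
have := sin_max x; have := cos_max x; rewrite /= normrN; lra.
Qed.

(** Two directions making an angle bounded away from [0] and [pi] span the
    plane with bounded coefficients. *)
Lemma unif_feasible_span B A s x y :
  0 < s -> s <= sin (y - x) -> 0 < A ->
  feas B (tang x) A -> feas B (tang y) A -> unif_feasible B (2 / s * A).
Proof.
move=> s0 sxy A0 Fx Fy v V V0 vV.
have S0 : 0 < sin (y - x) by apply: lt_le_trans sxy.
pose a := (v.1 * cos y + v.2 * sin y) / sin (y - x).
pose b := - (v.1 * cos x + v.2 * sin x) / sin (y - x).
have bound z : `|v.1 * cos z + v.2 * sin z| <= V.
  apply: le_trans (ler_normD _ _) _; rewrite !normrM.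
  have := ler_pM (normr_ge0 _) (normr_ge0 _) (lexx `|v.1|) (cos_max z).
  have := ler_pM (normr_ge0 _) (normr_ge0 _) (lexx `|v.2|) (sin_max z).
  lra.
have quot c : `|c| <= V -> `|c / sin (y - x)| <= V / s.
  move=> cV; rewrite normrM normfV (gtr0_norm S0).
  by apply: ler_pM => //; rewrite ?invr_ge0 ?(ltW S0) // lef_pV2.
have Vs : 0 < V / s by rewrite divr_gt0.
have -> : v = a *: tang x + b *: tang y.
  have comp c na nb px py : na * px + nb * py = c * sin (y - x) ->
      c = na / sin (y - x) * px + nb / sin (y - x) * py.
    move=> e; rewrite ![_ / sin (y - x) * _]mulrAC -mulrDl e mulfK //.
    by rewrite gt_eqF.
  by rewrite [LHS]surjective_pairing; congr pair; apply: comp; rewrite sinB /=; ring.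
have -> : V * (2 / s * A) = V / s * A + V / s * A by field; rewrite gt_eqF.
apply: feasible_add.
  by apply: feasible_scale => //; apply: quot; exact: bound.
by apply: feasible_scale => //; apply: quot; rewrite normrN; exact: bound.
Qed.

Lemma feasible_turn B A A' x x' : `|x - x'| <= h ->
  feas B (tang x') A -> unif_feasible B A' -> feas B (tang x) (A + 2 * h * A').
Proof.
move=> xx' F U; rewrite -[tang x](subrK (tang x')) addrC.
apply: feasible_add => //; apply: U; first by rewrite mulr_gt0.
have := le_trans (sin_lip x x') xx'; have := le_trans (cos_lip x x') xx'.
by rewrite /= -opprD normrN; lra.
Qed.

Definition cells (i j : nat) : set nat := [set k | (i <= k < j)%N].

(** Turning a tangential motion through a small angle removes one cell from the
    end of the arc that still has to be dealt with, at the price of a short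
    correction of length [O(h)] in a direction where the previous bound applies
    with a constant factor.  So the cost grows by a factor [1 + O(h)] per cell,
    which stays bounded over the [O(1/h)] cells of an arc.  Both ends of the arc
    have to be treated, since the correction is written in terms of the tangents
    at the two ends; [G] is a set of cells that is left untouched. *)
Lemma feasible_growth G s e0 (L0 L1 lo hi : nat) :
  0 < s -> cell_cost r h <= e0 ->
  (forall L : nat, (L0 <= L <= L1)%N -> s <= sin (L%:R * h)) ->
  (forall i, (lo <= i)%N -> (i + L0 <= hi)%N ->
     unif_feasible (cells i (i + L0) `|` G) e0) ->
  forall d i, (L0 + d <= L1)%N -> (lo <= i)%N -> (i + (L0 + d) <= hi)%N ->
    unif_feasible (cells i (i + (L0 + d)) `|` G)
      (2 / s * ((1 + 4 * h / s) ^+ d * (2 * e0))).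
Proof.
move=> s0 he sL base.
have e00 : 0 < e0 by apply: lt_le_trans he; exact: cell_cost_gt0.
set A := fun d : nat => (1 + 4 * h / s) ^+ d * (2 * e0).
have q1 : 1 <= 1 + 4 * h / s by rewrite lerDl divr_ge0 ?mulr_ge0 ?(ltW h0) // ltW.
have Age d : 2 * e0 <= A d.
  by rewrite /A ler_peMl ?exprn_ege1 // mulr_ge0 // ltW.
have A0 d : 0 < A d by apply: lt_le_trans (Age d); lra.
have AS d : A d.+1 = A d + 2 * h * (2 / s * A d).
  by rewrite /A exprS; field; rewrite gt_eqF.
have span d i : (L0 + d <= L1)%N ->
    feas (cells i (i + (L0 + d)) `|` G) (tang (i%:R * h)) (A d) ->
    feas (cells i (i + (L0 + d)) `|` G) (tang ((i + (L0 + d))%:R * h)) (A d) ->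
    unif_feasible (cells i (i + (L0 + d)) `|` G) (2 / s * A d).
  move=> dL; apply: unif_feasible_span => //.
  rewrite -mulrBl natrD addrC addKr; apply: sL.
  by rewrite leq_addr.
suff ends d i : (L0 + d <= L1)%N -> (lo <= i)%N -> (i + (L0 + d) <= hi)%N ->
    feas (cells i (i + (L0 + d)) `|` G) (tang (i%:R * h)) (A d) /\
    feas (cells i (i + (L0 + d)) `|` G) (tang ((i + (L0 + d))%:R * h)) (A d).
  move=> d i dL il ih; have [F1 F2] := ends d i dL il ih.
  exact: span.
elim: d i => [|d IH] i dL il ih.
  rewrite addn0 in ih *; have U := base i il ih.
  by rewrite /A expr0 mul1r; split; exact: unif_feasible_tang.
have dL' : (L0 + d <= L1)%N by rewrite ltnW // -addnS.
have heA : cell_cost r h <= A d.+1 by have := Age d.+1; lra.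
have hh : `|h| <= h by rewrite gtr0_norm.
split.
  have [||F1 F2] := IH i.+1 dL'; first exact: ltnW.
    by rewrite addSnnS -addnS.
  have U := span _ _ dL' F1 F2.
  apply: (@feasible_collapse _ _ _ _ r0 h0 h1 _ i) => //; first by rewrite lexx lerDl ltW.
  rewrite AS; apply: (@feasible_turn _ _ _ _ (i.+1%:R * h)).
  - by rewrite -mulrBl -natr1 opprD addrA subrr add0r mulN1r normrN.
  - apply: feasible_sub F1 => // k [[/andP[k1 k2]|Gk] ki]; last by exists k => //; right.
    exists k => //; left; rewrite /cells /= addSnnS -addnS k2 andbT ltn_neqAle k1 andbT.
    by apply/eqP => e1; apply: ki.
  - apply: unif_feasible_sub U => // k [[/andP[k1 k2]|Gk] ki]; last by exists k => //; right.
    exists k => //; left; rewrite /cells /= addSnnS -addnS k2 andbT ltn_neqAle k1 andbT.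
    by apply/eqP => e1; apply: ki.
have [||F1 F2] := IH i dL'; first by [].
  by apply: leq_trans ih; rewrite leq_add2l addnS.
have U := span _ _ dL' F1 F2.
have BS k : ((cells i (i + (L0 + d.+1)) `|` G) `\ (i + (L0 + d))%N) k ->
    (cells i (i + (L0 + d)) `|` G) k.
  move=> [[/andP[k1 k2]|Gk] ki]; last by right.
  left; rewrite /cells /= k1 /= ltn_neqAle; apply/andP; split; first exact/eqP.
  by rewrite -ltnS -addnS -addnS.
apply: (@feasible_collapse _ _ _ _ r0 h0 h1 _ (i + (L0 + d))%N) => //.
  by rewrite !addnS -natr1 mulrDl mul1r lexx andbT lerDl ltW.
rewrite AS; apply: (@feasible_turn _ _ _ _ ((i + (L0 + d))%:R * h)).
- by rewrite -mulrBl !addnS -natr1 addrAC subrr add0r mul1r.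
- by apply: feasible_sub F2 => // k /BS Bk; exists k.
- by apply: unif_feasible_sub U => // k /BS Bk; exists k.
Qed.

End Growth.

(** * Translations of small cost *)

Section Translation.
Context {R : realType}.

Lemma sin_ge_sym (a x : R) : 0 <= a -> a <= x <= pi - a -> sin a <= sin x.
Proof.
move=> a0 /andP[ax xa]; rewrite -subr_ge0 sinB_half.
have := pi_ge0 R => p0.
rewrite mulr_ge0 ?mulr_ge0 //.
  by apply: cos_ge0_pihalf; apply/andP; split; lra.
by apply: sin_ge0_pi; apply/andP; split; lra.
Qed.

Lemma growth_factor_le (x : R) (d n : nat) : 0 <= x -> (d <= n)%N ->
  (1 + x) ^+ d <= expR (n%:R * x).
Proof.
move=> x0 dn; apply: (@le_trans _ _ (expR x ^+ d)).
  by rewrite lerXn2r ?nnegrE ?expR_ge0 ?addr_ge0 // expR_ge1Dx.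
by rewrite -expRM_natl ler_expR ler_wpM2r // ler_nat.
Qed.

Variables (r kappa : R).
Hypotheses (r0 : 0 < r) (kappa0 : 0 < kappa).

Definition circle0 : set (plane R) := [set z | z.1 ^+ 2 + z.2 ^+ 2 = r ^+ 2].

Lemma circle0_dir z : circle0 z ->
  exists2 x, 0 <= x <= pi & z = r *: dir x \/ z = - (r *: dir x).
Proof.
wlog z2 : z / 0 <= z.2 => [hw zr|zr].
  case: (leP 0 z.2) => z2; first exact: hw.
  have [||x x0 zx] := hw (- z); first by rewrite /= oppr_ge0 ltW.
    by rewrite /circle0 /= !sqrrN.
  exists x => //; rewrite -[z]opprK.
  by case: zx => ->; [right|left]; rewrite ?opprK.
have rn : r != 0 by rewrite gt_eqF.
have z1 : -1 <= z.1 / r <= 1.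
  rewrite ler_pdivlMr // ler_pdivrMr // mulN1r mul1r.
  rewrite -ler_norml -[leRHS](gtr0_norm r0) -ler_sqr ?nnegrE ?normr_ge0 //.
  by rewrite !real_normK ?num_real // -zr lerDl sqr_ge0.
exists (acos (z.1 / r)); first by rewrite acos_ge0 ?acos_lepi.
left; rewrite /dir acosK ?in_itv // sin_acos //.
rewrite [LHS]surjective_pairing; congr pair; rewrite /= /GRing.scale /=.
  by rewrite mulrC divfK.
have -> : 1 - (z.1 / r) ^+ 2 = (z.2 / r) ^+ 2.
  rewrite [RHS]expr_div_n (_ : z.2 ^+ 2 = r ^+ 2 - z.1 ^+ 2); first by field.
  by rewrite -zr; ring.
by rewrite sqrtr_sqr ger0_norm ?divr_ge0 ?(ltW r0) // mulrC divfK.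
Qed.

(** The half-turn is divided into [2 * M * q] cells of angle [h].  The number [M]
    is fixed by the size of the gap, so that the gap hides [q] consecutive cells;
    refining the mesh means increasing [q], and [C] does not change then. *)
Section Mesh.
Variables (M q : nat) (h : R).
Hypotheses (M3 : (3 <= M)%N) (q0 : (0 < q)%N) (h0 : 0 < h) (h1 : h <= 1).
Hypotheses (hpi : (2 * M * q)%:R * h = pi) (hid : r * (q%:R * h) < kappa).

Local Notation n := (2 * M * q)%N.
Local Notation s := (sin (q%:R * h)).
Local Notation C := (4 / s * expR (4 * pi / s)).
Local Notation e0 := (cell_cost r h).
Local Notation unif := (unif_feasible r kappa h).

Let e0_gt0 : 0 < e0 := cell_cost_gt0 r0 h0.

Lemma mesh_sin (L : nat) : (q <= L <= n - q)%N -> s <= sin (L%:R * h).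
Proof.
move=> /andP[qL Ln]; apply: sin_ge_sym; first by rewrite mulr_ge0 ?(ltW h0).
rewrite ler_pM2r // ler_nat qL /= -hpi -mulrBl ler_pM2r //.
by rewrite -natrB ?ler_nat //; nia.
Qed.

Lemma mesh_s_gt0 : 0 < s.
Proof.
have q0' : 0 < q%:R :> R by rewrite ltr0n.
apply: sin_gt0_pi; rewrite mulr_gt0 // -hpi ltr_pM2r // ltr_nat.
by nia.
Qed.

Lemma mesh_C_gt0 : 0 < C.
Proof. by rewrite mulr_gt0 ?expR_gt0 // divr_gt0 ?mesh_s_gt0. Qed.

Lemma mesh_cost (d : nat) e : 0 < e -> (d <= n)%N ->
  2 / s * ((1 + 4 * h / s) ^+ d * (2 * e)) <= C * e.
Proof.
move=> e00 dn; have sp := mesh_s_gt0.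
have x0 : 0 <= 4 * h / s by rewrite divr_ge0 ?mulr_ge0 // ltW.
have := growth_factor_le x0 dn.
rewrite (_ : n%:R * (4 * h / s) = 4 * pi / s); last by rewrite -hpi; ring.
move=> g; have {}g := ler_wpM2r (ltW e00) g.
have {}g := ler_wpM2l (_ : 0 <= 4 / s) g.
have s4 : 0 <= 4 / s by rewrite divr_ge0 // ltW.
move: (g s4); congr (_ <= _); ring.
Qed.

(** Down to length [q] an arc is shortened from its ends, and then the gap hides
    it. *)
Lemma unif_feasible_arc i (L : nat) : (q <= L <= n - q)%N ->
  unif (cells i (i + L)) (C * e0).
Proof.
move=> /andP[qL Ln].
have base (j : nat) : unif (cells j (j + q) `|` set0) e0.
  move=> v V V0 vV; apply: (@feasible_hidden _ _ _ _ r0 _ _ (j%:R * h)).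
    by rewrite mulr_gt0 // e0_gt0.
  move=> k x [/andP[jk kj]|//] /andP[kx xk]; apply: le_lt_trans hid.
  rewrite ler_pM2l //; apply: le_trans (norm_sin_le _) _.
  have k1 : j%:R * h <= k%:R * h by rewrite ler_pM2r // ler_nat.
  have k2 : k.+1%:R * h <= (j + q)%:R * h by rewrite ler_pM2r // ler_nat.
  rewrite -natr1 natrD !mulrDl mul1r in k2.
  by rewrite ger0_norm; lra.
have dE : L = (q + (L - q))%N by rewrite subnKC.
have := feasible_growth r0 h0 h1 mesh_s_gt0 (lexx e0) mesh_sin
  (lo := 0) (hi := i + L) (fun j _ _ => base j) (d := L - q) (i := i).
rewrite -dE => /(_ Ln (leq0n _) (leqnn _)).
apply: unif_feasible_sub; last by move=> k Bk; exists k => //; left.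
apply: mesh_cost; first exact: e0_gt0.
by apply: leq_trans (leq_subr _ _) _; apply: leq_trans Ln (leq_subr _ _).
Qed.

Lemma cell_period k : cell r h k `<=` cell r h (k + n).
Proof.
move=> z [x /andP[kx xk] zx]; exists (x + pi).
  by rewrite natrD mulrDl hpi; apply/andP; split; lra.
have -> : dir (x + pi) = - dir x by rewrite /dir sinDpi cosDpi.
by rewrite scalerN opprK; case: zx; [right|left].
Qed.

(** The half-turn cannot be shortened from its own two ends, whose tangents are
    parallel.  Instead its first quarter is shortened from both ends, whose
    tangents are far from parallel.  Once [2 * q] cells are gone, one end has
    lost at least [q] of them, and modulo [pi] the remaining cells lie in an arc
    of [2 * M * q - q] cells. *)
Lemma unif_feasible_full : unif (cells 0 n) (C * (C * e0)).
Proof.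
have Ce : e0 <= C * e0.
  have sp := mesh_s_gt0.
  rewrite ler_peMl ?(ltW e0_gt0) //.
  have : 1 <= 4 / s by rewrite ler_pdivlMr // mul1r; have := sin_le1 (q%:R * h); lra.
  have : 1 <= expR (4 * pi / s).
    rewrite -[leLHS]expR0 ler_expR; apply: divr_ge0; last exact: ltW.
    by rewrite mulr_ge0 ?pi_ge0.
  by move=> a b; rewrite mulr_ege1.
have base (i : nat) : (0 <= i)%N -> (i + (M - 2) * q <= M * q)%N ->
    unif (cells i (i + (M - 2) * q) `|` cells (M * q) n) (C * e0).
  move=> _ iM; have [qi|iq] := leqP q i.
    have F := @unif_feasible_arc q (n - q) _.
    apply: unif_feasible_sub (F _) => //; last by nia.
    move=> k [|] /andP[k1 k2]; exists k => //; rewrite /cells /=; nia.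
  have F := @unif_feasible_arc (M * q) (n - q) _.
  apply: unif_feasible_sub (F _) => //; last by nia.
  move=> k [|] /andP[k1 k2].
    by exists (k + n)%N; [rewrite /cells /=; nia|exact: cell_period].
  by exists k => //; rewrite /cells /=; nia.
have sn (L : nat) : ((M - 2) * q <= L <= M * q)%N -> s <= sin (L%:R * h).
  by move=> /andP[L1 L2]; apply: mesh_sin; nia.
have := feasible_growth r0 h0 h1 mesh_s_gt0 Ce sn base (d := 2 * q) (i := 0).
have -> : (0 + ((M - 2) * q + 2 * q) = M * q)%N by nia.
have -> : ((M - 2) * q + 2 * q = M * q)%N by nia.
move=> /(_ (leqnn _) isT (leqnn _)).
apply: unif_feasible_sub.
  apply: mesh_cost; last by nia.
  by rewrite mulr_gt0 ?mesh_C_gt0 // e0_gt0.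
move=> k /andP[k1 k2]; exists k => //.
by case: (ltnP k (M * q)) => km; [left|right]; rewrite /cells /= ?km ?k2.
Qed.

Lemma sweep_circle0_sub l : sweep (visible_part kappa circle0) l `<=`
  \bigcup_(k in [set k | (k < n)%N]) sweep (visible_part kappa (cell r h k)) l.
Proof.
have n0 : (0 < n)%N by rewrite !muln_gt0 q0 (leq_trans _ M3).
elim: l => [//|m l IH] z /= [[t [w [t01 [cw vw] ->]]]|/IH]; last first.
  by case=> k kn hk; exists k => //; right.
have [x /andP[x0 xpi] wx] := circle0_dir cw.
suff [k kn kx] : exists2 k, (k < n)%N & k%:R * h <= x <= k%:R * h + h.
  by exists k => //; left; exists t, w; split => //; split => //; exists x.
have xh : 0 <= x / h by rewrite divr_ge0 // ltW.
have /andP[k1 k2] := truncn_itv xh.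
rewrite ler_pdivlMr // in k1; rewrite ltr_pdivrMr // -natr1 mulrDl mul1r in k2.
have [kn|kn] := ltnP (Num.truncn (x / h)) n.
  by exists (Num.truncn (x / h)) => //; rewrite k1 ltW.
exists n.-1; first by rewrite ltn_predL.
have e1 : n.-1%:R * h + h = pi.
  by rewrite -hpi -[in RHS](prednK n0) -natr1 [in RHS]mulrDl mul1r.
have : pi <= (Num.truncn (x / h))%:R * h by rewrite -hpi ler_pM2r // ler_nat.
by rewrite e1 xpi andbT; lra.
Qed.

End Mesh.

(** The cost per cell is [O(h ^+ 2)] with constants independent of the mesh,
    so the sum over the cells is [O(h)]. *)
Lemma small_translation (v : plane R) (e : R) : 0 < e -> exists l,
  endpoint l = v /\ coverable (sweep (visible_part kappa circle0) l) e.
Proof.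
move=> e0.
(* The gap hides the directions at angle [rho] from its axis; [M >= 3] leaves
   room for the arcs of the two stages. *)
pose M := (Num.truncn (r * pi / kappa)).+3.
have pi0 := pi_gt0 R.
have MR : r * pi / kappa < M%:R.
  have /andP[_ h] : (Num.truncn (r * pi / kappa))%:R <= r * pi / kappa
      < (Num.truncn (r * pi / kappa)).+1%:R.
    by apply: truncn_itv; rewrite divr_ge0 ?mulr_ge0 // ltW.
  by apply: lt_le_trans h _; rewrite ler_nat /M leqW // leqW.
have M3 : (3 <= M)%N by [].
have M0 : 3 <= M%:R :> R by rewrite (ler_nat _ 3).
clearbody M.
pose rho : R := pi / (2 * M%:R).
have rho0 : 0 < rho by rewrite divr_gt0 //; lra.
have rho1 : rho <= 1.
  by rewrite /rho ler_pdivrMr ?mul1r; have := pihalf_lt2 R; lra.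
have rhok : r * rho < kappa.
  have : r * pi < M%:R * kappa by rewrite -ltr_pdivrMr.
  rewrite /rho mulrA ltr_pdivrMr; last by lra.
  have : 0 < M%:R * kappa by rewrite mulr_gt0 //; lra.
  lra.
pose V := `|v.1| + `|v.2| + 1.
have V0 : 0 < V by have := normr_ge0 v.1; have := normr_ge0 v.2; rewrite /V; lra.
pose C := 4 / sin rho * expR (4 * pi / sin rho).
(* The total cost on the mesh of parameter [q] is [K / q]. *)
pose K := V * (C * (C * (pi / rho * cell_cost r rho))).
pose q := (Num.truncn (`|K| / e)).+1.
have Kq : K < q%:R * e.
  rewrite -ltr_pdivrMr //.
  have /andP[_ h] : (Num.truncn (`|K| / e))%:R <= `|K| / e
      < (Num.truncn (`|K| / e)).+1%:R.
    by apply: truncn_itv; rewrite divr_ge0 // ltW.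
  apply: le_lt_trans h.
  by rewrite ler_pM2r ?invr_gt0 // ler_norm.
have q0 : (0 < q)%N by [].
have qR : 1 <= q%:R :> R by rewrite ler1n.
clearbody q.
pose h := rho / q%:R.
have qh : q%:R * h = rho by rewrite /h mulrC divfK // gt_eqF //; lra.
have h0 : 0 < h by rewrite divr_gt0 //; lra.
have h1 : h <= 1 by rewrite /h ler_pdivrMr; lra.
have hpi : (2 * M * q)%:R * h = pi.
  by rewrite natrM -mulrA qh /rho natrM mulrC divfK // gt_eqF //; lra.
have hid : r * (q%:R * h) < kappa by rewrite qh.
have U := unif_feasible_full M3 q0 h0 h1 hpi hid.
rewrite qh -/C in U.
have vV : `|v.1| + `|v.2| <= V by rewrite /V; lra.
have [l [l1 _ l3]] := U v V V0 vV 1 1 ltr01 ltr01.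
exists l; split; first by rewrite l1 scale1r.
apply: coverable_sub (sweep_circle0_sub M3 q0 h0 hpi (l := l)) _.
have n0 : (0 < 2 * M * q)%N by rewrite !muln_gt0 q0 (leq_trans _ M3).
set cost := V * (C * (C * _)) in U l3.
have costE : (2 * M * q)%:R * (1 * cost) = K / q%:R.
  have qn0 : q%:R != 0 :> R by rewrite gt_eqF //; lra.
  have rn0 : rho != 0 by rewrite gt_eqF.
  have cE : cell_cost r h = cell_cost r rho / q%:R ^+ 2.
    by rewrite /cell_cost /h; field.
  have nE : (2 * M * q)%:R = pi * q%:R / rho :> R.
    by rewrite -hpi /h; field; rewrite qn0 rn0.
  rewrite nE /cost cE /K.
  move: (cell_cost r rho) => cc; clear -qn0 rn0.
  by field; rewrite qn0 rn0.
apply: (@coverable_le _ _ ((2 * M * q)%:R * (1 * cost))).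
  by rewrite costE ler_pdivrMr ?ltW // ?[e * _]mulrC //; lra.
rewrite -(prednK n0); apply: coverable_bigU => k; rewrite (prednK n0) => kn.
by apply: l3; rewrite /cells /= kn.
Qed.

End Translation.

(** * Area and rigid motions *)

Section Area.
Context {R : realType}.

Lemma area_square (b : plane R * R) :
  (area [set q | near_pt b.2 b.1 q] <= ((2 * b.2) ^+ 2)%:E)%E.
Proof.
case: b => -[x y] h /=.
have -> : [set q : plane R | near_pt h (x, y) q] =
    `[x - h, x + h]%classic `*` `[y - h, y + h]%classic.
  by apply/seteqP; split => q /=; rewrite /near_pt /= !in_itv /= !ler_distl.
set S := _ `*` _.
have -> : area S = ((@lebesgue_measure R \x @lebesgue_measure R) S)%E.
  by rewrite /area measurable_mu_extE //; apply: measurableX; exact: measurable_itv.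
rewrite product_measure1E; [|exact: measurable_itv..].
rewrite /= !lebesgue_measure_itv /= !lte_fin.
have side (z : R) : z + h - (z - h) = 2 * h by ring.
case: ltP => xh; last by rewrite mul0e lee_fin sqr_ge0.
case: ltP => yh; last by rewrite mule0 lee_fin sqr_ge0.
by rewrite -!EFinB -EFinM lee_fin !side expr2.
Qed.

Lemma area_coverable (X : set (plane R)) e : coverable X e -> (area X < e%:E)%E.
Proof.
case=> s [sX]; rewrite -lte_fin; apply: le_lt_trans.
have mono (A B : set (plane R)) : A `<=` B -> (area A <= area B)%E.
  by move=> AB; exact: le_mu_ext.
elim: s X sX => [|b s IH] X sX.
  rewrite big_nil (_ : X = set0); last first.
    by apply/seteqP; split => // q /sX [].
  by rewrite /area mu_ext0.
rewrite big_cons EFinD.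
pose Y := [set q | exists2 b', b' \in s & near_pt b'.2 b'.1 q].
have XY : X `<=` [set q | near_pt b.2 b.1 q] `|` Y.
  move=> q /sX [b']; rewrite inE => /orP[/eqP ->|b's] qb; first by left.
  by right; exists b'.
apply: le_trans (mono _ _ XY) _.
apply: le_trans (outer_measureU2 _ _ _) _.
by apply: leeD; [exact: area_square|exact: IH].
Qed.

End Area.

Section Motions.
Context {R : realType}.
Implicit Types (z c : plane R) (a t : R) (p m : plane R * R).

Definition turn a z : plane R :=
  (cos a * z.1 - sin a * z.2, sin a * z.1 + cos a * z.2).

(** The rigid motions in coordinates that separate the displacement of the
    centre [c] from the rotation about it. *)
Definition rigid c p z : plane R := c + p.1 + turn p.2 (z - c).

Lemma turnB a z z' : turn a z - turn a z' = turn a (z - z').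
Proof. by congr pair => /=; ring. Qed.

Lemma turn0 z : turn 0 z = z.
Proof. by rewrite /turn cos0 sin0 !mul1r !mul0r subr0 add0r -surjective_pairing. Qed.

Lemma signed_area_turn a z z' : signed_area (turn a z) (turn a z') = signed_area z z'.
Proof.
rewrite /signed_area /= -[RHS]mul1r -(cos2Dsin2 a); ring.
Qed.

Lemma rigidB c p z z' : rigid c p z - rigid c p z' = turn p.2 (z - z').
Proof. by rewrite /rigid opprD addrACA subrr add0r turnB opprB addrA subrK. Qed.

Lemma rigid_isom_plus c p : isom_plus (rigid c p).
Proof.
split=> [z z'|z z' z'']; last by rewrite !rigidB signed_area_turn.
rewrite /edist; congr Num.sqrt.
have e := rigidB c p z z'.
have -> : (rigid c p z).1 - (rigid c p z').1 = (turn p.2 (z - z')).1 by rewrite -e.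
have -> : (rigid c p z).2 - (rigid c p z').2 = (turn p.2 (z - z')).2 by rewrite -e.
by rewrite /= -[RHS]mul1r -(cos2Dsin2 p.2); ring.
Qed.

Lemma angle_exists x y : x ^+ 2 + y ^+ 2 = 1 :> R ->
  exists a, x = cos a /\ y = sin a.
Proof.
move=> xy; have [|a _ h] := @circle0_dir R 1 ltr01 (x, y).
  by rewrite /circle0 /= xy expr1n.
rewrite scale1r in h; case: h => [[-> ->]|[-> ->]]; first by exists a.
by exists (a + pi); rewrite cosDpi sinDpi.
Qed.

(** The images of the two unit vectors are orthonormal and positively oriented,
    and inner products with them determine all other images. *)
Lemma isom_plus_rigid c (g : plane R -> plane R) : isom_plus g ->
  exists p, g = rigid c p.
Proof.
case=> iso ori.
pose f u := g (c + u) - g c.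
have dist2 (u v : plane R) : ((f u).1 - (f v).1) ^+ 2 + ((f u).2 - (f v).2) ^+ 2
    = (u.1 - v.1) ^+ 2 + (u.2 - v.2) ^+ 2.
  have := congr1 (fun x => x ^+ 2) (iso (c + u) (c + v)).
  rewrite /edist !sqr_sqrtr ?addr_ge0 ?sqr_ge0 // /f /=.
  have e (x y z : R) : x + y - (x + z) = y - z by ring.
  have e' (x y z : R) : x - z - (y - z) = x - y by ring.
  by rewrite !e !e'.
have f0 : f 0 = 0 by rewrite /f addr0 subrr.
have norm2 (u : plane R) : (f u).1 ^+ 2 + (f u).2 ^+ 2 = u.1 ^+ 2 + u.2 ^+ 2.
  by have := dist2 u 0; rewrite f0 /= !subr0.
have inner (u v : plane R) : (f u).1 * (f v).1 + (f u).2 * (f v).2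
    = u.1 * v.1 + u.2 * v.2.
  by have := dist2 u v; have := norm2 u; have := norm2 v; lra.
have gE z : g z = f (z - c) + g c by rewrite /f addrC [c + _]addrC !subrK addrC subrK.
have o : 0 < signed_area (f (1, 0)) (f (0, 1)).
  have := ori c (c + (1, 0)) (c + (0, 1)); rewrite -/(f (1, 0)) -/(f (0, 1)).
  rewrite ![c + _ - c]addrC !addKr; apply.
  by rewrite /signed_area /= mulr1 mulr0 subr0 ltr01.
clearbody f.
have := inner (0, 1) (0, 1); have := inner (1, 0) (1, 0); have := inner (1, 0) (0, 1).
have i1 := inner ^~ (1, 0); have i2 := inner ^~ (0, 1).
move: o i1 i2; rewrite /signed_area /=.
move: (f (1, 0)) (f (0, 1)) => [x y] [x' y'] /= o i1 i2.
rewrite !(mulr0, mulr1, mul0r, addr0, add0r) => o12 o11 o22.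
have det1 : x * y' - y * x' = 1.
  have : (x * y' - y * x' - 1) * (x * y' - y * x' + 1) = 0.
    have -> : (x * y' - y * x' - 1) * (x * y' - y * x' + 1) =
      (x * x + y * y) * (x' * x' + y' * y') - (x * x' + y * y') ^+ 2 - 1 by ring.
    by rewrite o11 o22 o12; ring.
  by move/eqP; rewrite mulf_eq0 => /orP[]/eqP; lra.
have yE : y' = x.
  have : y' * (x * x + y * y) = x * (x * y' - y * x') + y * (x * x' + y * y') by ring.
  by rewrite o11 det1 o12; lra.
have xE : x' = - y.
  have : x' * (x * x + y * y) = x * (x * x' + y * y') - y * (x * y' - y * x') by ring.
  by rewrite o11 det1 o12; lra.
have [|a [xa ya]] := @angle_exists x y; first by rewrite !expr2.
exists (g c - c, a); apply/funext => z.
rewrite /rigid /= [c + _]addrC subrK [LHS]gE addrC; congr (_ + _).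
have := i1 (z - c); have := i2 (z - c).
rewrite !(mulr0, mulr1, addr0, add0r) xE yE => j2 j1.
rewrite [LHS]surjective_pairing /turn -xa -ya; congr pair.
  by rewrite -j1 -j2 -[LHS]mulr1 -o11; ring.
by rewrite -j1 -j2 -[LHS]mulr1 -o11; ring.
Qed.

End Motions.

(** * From itineraries to continuous motions *)

Section Paths.
Context {R : realType}.
Local Notation config := (plane R * R)%type.
Implicit Types (m p : config) (ms : seq config) (t : R).

(** Constant outside [0, 1], so that a concatenation of motions is the sum of
    the clamped motions, and its continuity needs no gluing. *)
Definition clamp t : R := Num.min 1 (Num.max 0 t).

Fixpoint run ms t : config :=
  if ms is m :: ms' then clamp t *: m + run ms' (t - 1) else 0.

Fixpoint visited ms : set config :=
  if ms is m :: ms' then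
    [set p | exists2 t, 0 <= t <= 1 & p = t *: m]
    `|` [set p | visited ms' (p - m)]
  else [set 0].

Lemma run_le0 ms t : t <= 0 -> run ms t = 0.
Proof.
elim: ms t => [//|m ms IH] t t0 /=; rewrite IH; last by lra.
by rewrite /clamp max_l // min_r ?ler01 // scale0r addr0.
Qed.

Lemma run_visited ms t : visited ms (run ms t).
Proof.
elim: ms t => [//|m ms IH] t /=; case: (leP t 1) => t1.
  left; exists (clamp t).
    by rewrite /clamp le_min ler01 le_max lexx /= ge_min lexx.
  by rewrite run_le0 ?addr0 //; lra.
right; rewrite /= [clamp t](_ : _ = 1) ?scale1r; first by rewrite addrC addKr.
by rewrite /clamp max_r ?min_l //; lra.
Qed.

Lemma run_end ms : run ms (size ms)%:R = \sum_(m <- ms) m.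
Proof.
elim: ms => [|m ms IH]; first by rewrite big_nil.
rewrite big_cons /= -natr1 addrK IH; congr (_ + _).
by rewrite /clamp max_r ?min_l ?scale1r // ?addr_ge0 // lerDr.
Qed.

Lemma clamp_continuous : continuous clamp.
Proof.
move=> t; apply: (@continuous_min _ _ (fun=> 1) (fun t => Num.max 0 t)).
  exact: cvg_cst.
by apply: (@continuous_max _ _ (fun=> 0) id); [exact: cvg_cst|exact: cvg_id].
Qed.

Lemma run_continuous ms : continuous (run ms).
Proof.
elim: ms => [|m ms IH] t /=; first exact: cvg_cst.
apply: cvgD; first by apply: cvgZr_tmp; exact: clamp_continuous.
apply: (@continuous_comp _ _ _ (fun t => t - 1) (run ms)); last exact: IH.
by apply: cvgB; [exact: cvg_id|exact: cvg_cst].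
Qed.

Lemma fst_continuous (A B : topologicalType) : continuous (@fst A B).
Proof. by move=> x; exact: cvg_fst. Qed.

Lemma snd_continuous (A B : topologicalType) : continuous (@snd A B).
Proof. by move=> x; exact: cvg_snd. Qed.

Lemma continuous_pair (T A B : topologicalType) (f : T -> A) (g : T -> B) (x : T) :
  {for x, continuous f} -> {for x, continuous g} ->
  {for x, continuous (fun y => (f y, g y))}.
Proof. by move=> cf cg; apply: cvg_pair. Qed.

Lemma rigid_continuous (c : plane R) (f : R -> config) : continuous f ->
  continuous (fun x : R * plane R => rigid c (f x.1) x.2).
Proof.
move=> cf x.
have cP : {for x, continuous (fun x : R * plane R => f x.1)}.
  by apply: continuous_comp; [exact: fst_continuous|exact: cf].
have c1 : {for x, continuous (fun x : R * plane R => (f x.1).1.1)}.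
  apply: (continuous_comp (continuous_comp cP _) _); exact: fst_continuous.
have c2 : {for x, continuous (fun x : R * plane R => (f x.1).1.2)}.
  apply: (continuous_comp (continuous_comp cP _) _).
    exact: fst_continuous.
  exact: snd_continuous.
have ca : {for x, continuous (fun x : R * plane R => (f x.1).2)}.
  by apply: (continuous_comp cP _); exact: snd_continuous.
have ccos : {for x, continuous (fun x : R * plane R => cos (f x.1).2)}.
  by apply: (continuous_comp ca _); exact: continuous_cos.
have csin : {for x, continuous (fun x : R * plane R => sin (f x.1).2)}.
  by apply: (continuous_comp ca _); exact: continuous_sin.
have s2 := @snd_continuous R (plane R) x.
have z1 : {for x, continuous (fun x : R * plane R => x.2.1 - c.1)}.
  apply: cvgB; last exact: cvg_cst.
  by apply: (continuous_comp s2 _); exact: fst_continuous.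
have z2 : {for x, continuous (fun x : R * plane R => x.2.2 - c.2)}.
  apply: cvgB; last exact: cvg_cst.
  by apply: (continuous_comp s2 _); exact: snd_continuous.
suff : {for x, continuous (fun x : R * plane R =>
  (c.1 + (f x.1).1.1 + (cos (f x.1).2 * (x.2.1 - c.1) - sin (f x.1).2 * (x.2.2 - c.2)),
   c.2 + (f x.1).1.2 + (sin (f x.1).2 * (x.2.1 - c.1) + cos (f x.1).2 * (x.2.2 - c.2))))} by [].
apply: continuous_pair.
  apply: cvgD; first by apply: cvgD; [exact: cvg_cst|exact: c1].
  by apply: cvgB; apply: cvgM.
apply: cvgD; first by apply: cvgD; [exact: cvg_cst|exact: c2].
by apply: cvgD; apply: cvgM.
Qed.

End Paths.

Section Assembly.
Context {R : realType}.
Variables (r kappa psi : R).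
Implicit Types (l : seq (plane R * R)) (z : plane R).

(** Every displacement is preceded by a turn that brings the gap from its
    original axis [psi] to the prescribed one, and followed by the turn back, so
    that consecutive displacements are independent of each other. *)
Definition moves l : seq (plane R * R) :=
  flatten [seq [:: (0, m.2 - psi); (m.1, 0); (0, psi - m.2)] | m <- l].

(** Copies of [X] at the vertices of the itinerary, where the rotations take
    place. *)
Fixpoint at_vertices (X : set (plane R)) l : set (plane R) :=
  if l is m :: l' then X `|` translate m.1 (at_vertices X l') else X.

Lemma at_vertices0 (X : set (plane R)) l : X `<=` at_vertices X l.
Proof. by case: l => // m l z Xz; left. Qed.

Lemma coverable_at_vertices (X : set (plane R)) l :
  (forall e, 0 < e -> coverable X e) ->
  forall e, 0 < e -> coverable (at_vertices X l) e.
Proof.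
move=> X0; elim: l => [//|m l IH] e e0 /=; rewrite [e]splitr.
by apply: coverableU; [apply: X0|apply: coverable_translate; apply: IH]; lra.
Qed.

(** A tangential sweep of vanishing length still contains the arc. *)
Lemma coverable_circle0 e : 0 < r -> 0 < e -> coverable (circle0 r) e.
Proof.
move=> r0 e0.
have cell0 k d : 0 < d -> coverable (cell r 1 k) d.
  move=> d0; have cc0 := cell_cost_gt0 r0 (@ltr01 R).
  have s0 : 0 < d / cell_cost r 1 by rewrite divr_gt0.
  pose x0 : R := k%:R * 1.
  have kk : x0 <= x0 <= x0 + 1 by rewrite lexx lerDl ler01.
  have cov := coverable_tangent_sweep r0 s0 ltr01 (lexx 1) kk.
  apply: (coverable_le _ (coverable_sub _ (coverableU cov (coverable_opp cov)))).
    rewrite -mulrDr -[leRHS](divfK (lt0r_neq0 cc0)).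
    by rewrite ler_pM2l // /cell_cost; lra.
  move=> z [x kx [|] ->]; [left|right]; exists 0, x;
    by rewrite lexx ler01 scale0r add0r ?opprK.
apply: (@coverable_le _ _ (4%:R * (e / 4%:R))); first by rewrite mulrC divfK.
apply: coverable_sub (coverable_bigU (X := cell r 1) (N := 3) _); last first.
  by move=> i _; apply: cell0; lra.
move=> z /(circle0_dir r0) [x /andP[x0 xpi] zx].
have x4 : x < 4 by have := pihalf_lt2 R; lra.
have /andP[k1 k2] := truncn_itv x0.
exists (Num.truncn x); first by rewrite /= truncn_lt_nat.
by exists x => //; rewrite mulr1 k1 -natr1 in k2 *; exact: ltW.
Qed.

Lemma circle0_turn a z : circle0 r z -> circle0 r (turn a z).
Proof. by rewrite /circle0 /= => <-; rewrite -[RHS]mul1r -(cos2Dsin2 a); ring. Qed.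

Lemma visible_turn a b z : visible kappa z b -> visible kappa (turn a z) (b + a).
Proof.
rewrite /visible /= sinD cosD => /le_trans; apply; rewrite le_eqVlt; apply/orP; left.
apply/eqP; congr (`|_|).
by rewrite -[LHS]mul1r -(cos2Dsin2 a); ring.
Qed.

(** The turns stay inside the circles at the vertices, and during a displacement
    the gap has the axis prescribed by its label. *)
Lemma visited_moves l b p z :
  visited (moves l ++ [:: (0, b)]) p -> visible_part kappa (circle0 r) psi z ->
  (sweep (visible_part kappa (circle0 r)) l `|` at_vertices (circle0 r) l)
    (p.1 + turn p.2 z).
Proof.
move=> vp [cz vz]; elim: l p vp => [|m l IH] p /=.
  case=> [[t _ ->]|/= /subr0_eq ->]; right; rewrite /= ?scaler0 add0r;
    exact: circle0_turn.
case=> [[t _ ->]|].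
  by right; left; rewrite /= scaler0 add0r; exact: circle0_turn.
case=> [[t t01 e1]|].
  left; left; exists t, (turn (m.2 - psi) z); split => //.
    split; first exact: circle0_turn.
    by have := visible_turn (m.2 - psi) vz; rewrite [psi + _]addrC subrK.
  have -> : p = (t *: m.1, m.2 - psi).
    rewrite -(subrK (0, m.2 - psi) p) e1; congr pair => /=; rewrite ?addr0 //.
    by rewrite scaler0 add0r.
  by [].
case=> [[t t01 e1]|].
  right; right; rewrite /translate /=.
  have -> : p.1 = m.1.
    rewrite -(subrK (0, m.2 - psi) p) -(subrK (m.1, 0) (p - _)) e1 /=.
    by rewrite scaler0 add0r addr0.
  by rewrite addrC addKr; apply: at_vertices0; exact: circle0_turn.
have -> : p - (0, m.2 - psi) - (m.1, 0) - (0, psi - m.2) = (p.1 - m.1, p.2).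
  by case: p => x y; congr pair => /=; rewrite ?subr0 //; ring.
move/IH; have -> : p.1 - m.1 + turn p.2 z = p.1 + turn p.2 z - m.1 by rewrite addrAC.
by case=> h; [left|right]; right.
Qed.

End Assembly.

(** * The gap and the conclusion *)

Section Gap.
Context {R : realType}.
Implicit Types (a c q z : plane R).

Lemma nbhs_near_pt a (U : set (plane R)) : nbhs a U ->
  exists2 h, 0 < h & forall q, near_pt h a q -> U q.
Proof.
move=> /nbhs_ballP [e /= e0 eU]; exists (e / 2); first by lra.
move=> q [q1 q2]; apply: eU; split; rewrite /= -ball_normE /ball_ /= distrC.
  by apply: le_lt_trans q1 _; lra.
by apply: le_lt_trans q2 _; lra.
Qed.

Lemma circle_circle0 c (r : R) q : 0 < r -> circle c r q -> circle0 r (q - c).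
Proof.
move=> r0; rewrite /circle /edist /circle0 /= => <-.
by rewrite sqr_sqrtr ?addr_ge0 ?sqr_ge0 //; ring.
Qed.

(** A point of the circle close to the axis of the gap is close to an end of the
    corresponding diameter. *)
Lemma hidden_near (r kappa psi : R) z : 0 < r -> kappa <= r ->
  circle0 r z -> ~ visible kappa z psi ->
  near_pt (2 * kappa) (r *: dir psi) z \/ near_pt (2 * kappa) (- (r *: dir psi)) z.
Proof.
move=> r0 kr zr /negP; rewrite -ltNge => zk.
pose x := z.1 * cos psi + z.2 * sin psi.
pose y := z.1 * sin psi - z.2 * cos psi.
have xy : x ^+ 2 + y ^+ 2 = r ^+ 2.
  by rewrite -zr -[RHS]mul1r -(cos2Dsin2 psi) /x /y; ring.
have z1 : z.1 = x * cos psi + y * sin psi.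
  by rewrite -[LHS]mulr1 -(cos2Dsin2 psi) /x /y; ring.
have z2 : z.2 = x * sin psi - y * cos psi.
  by rewrite -[LHS]mulr1 -(cos2Dsin2 psi) /x /y; ring.
rewrite -/y in zk; clearbody x y.
(* [(r - |x|) * (r + |x|) = y ^+ 2] and [|y| < kappa <= r]. *)
have xr : r - `|x| <= `|y|.
  have : x ^+ 2 = `|x| ^+ 2 by rewrite real_normK ?num_real.
  have : y ^+ 2 = `|y| ^+ 2 by rewrite real_normK ?num_real.
  have := normr_ge0 x; have := normr_ge0 y.
  move: xy => /[swap] y0 /[swap] x0 /[swap] -> /[swap] -> xy.
  rewrite leNgt; apply/negP => h; nra.
have rx : `|x| <= r.
  rewrite -[leRHS](gtr0_norm r0) -ler_sqr ?nnegrE ?normr_ge0 //.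
  by rewrite !real_normK ?num_real // -xy lerDl sqr_ge0.
have key (s co si : R) : `|s| <= `|y| -> `|co| <= 1 -> `|si| <= 1 ->
    `|s * co + y * si| <= 2 * kappa.
  move=> sy c1 s1; apply: le_trans (ler_normD _ _) _; rewrite !normrM.
  have := ler_pM (normr_ge0 _) (normr_ge0 _) sy c1.
  have := ler_pM (normr_ge0 _) (normr_ge0 _) (lexx `|y|) s1.
  lra.
have fin (s : R) : `|x - s| <= `|y| -> near_pt (2 * kappa) (s *: dir psi) z.
  move=> xs; split => /=; rewrite ?z1 ?z2 /GRing.scale /=.
    rewrite (_ : _ - _ = (x - s) * cos psi + y * sin psi); last by ring.
    by apply: key; rewrite ?cos_max ?sin_max.
  rewrite (_ : _ - _ = (x - s) * sin psi + y * (- cos psi)); last by ring.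
  by apply: key; rewrite ?normrN ?cos_max ?sin_max.
case: (leP 0 x) => x0; [left|right; rewrite -scaleNr]; apply: fin.
  by rewrite ger0_norm // in xr rx; rewrite ler0_norm; lra.
by rewrite ltr0_norm // in xr rx; rewrite ger0_norm; lra.
Qed.

End Gap.

Unset Implicit Arguments.

Theorem corollary1p3 (R : realType) (c : plane R) (r : R) (a b : plane R)
    (U : set (plane R)) (g : plane R -> plane R) (eps : R) :
  0 < r ->
  circle c r a -> circle c r b -> b - c = - (a - c) ->
  set_nbhs [set a; b] U ->
  isom_plus g ->
  0 < eps ->
  exists gamma : R -> {compact-open, plane R -> plane R},
    [/\ {within `[0, 1], continuous gamma},
        forall t : R, t \in `[0, 1] -> isom_plus (gamma t),
        gamma 0 = id,
        gamma 1 = g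
      & (area (\bigcup_(t in `[0%R, 1%R]) (gamma t @` (circle c r `\` U)))
           < eps%:E)%E].
Proof.
move=> r0 ca _ bc nU gisom eps0.
have [ha ha0 Ua] := nbhs_near_pt (nU a (or_introl erefl)).
have [hb hb0 Ub] := nbhs_near_pt (nU b (or_intror erefl)).
pose kappa := Num.min r (Num.min ha hb / 2).
have kr : kappa <= r by rewrite ge_min lexx.
have k0 : 0 < kappa by rewrite lt_min r0 divr_gt0 // lt_min ha0.
have kh : 2 * kappa <= Num.min ha hb.
  have : kappa <= Num.min ha hb / 2 by rewrite ge_min lexx orbT.
  by lra.
have [psi apsi] : exists psi, a - c = r *: dir psi.
  have := circle_circle0 r0 ca.
  move: (a - c) => [x y]; rewrite /circle0 /= => xy.
  have [|psi [xc yc]] := @angle_exists R (x / r) (y / r).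
    by rewrite !expr_div_n -mulrDl xy divff // sqrf_eq0 gt_eqF.
  exists psi; rewrite /dir -xc -yc; congr pair; rewrite /= /GRing.scale /=.
    by rewrite mulrC divfK // gt_eqF.
  by rewrite mulrC divfK // gt_eqF.
have seen q : (circle c r `\` U) q -> visible_part kappa (circle0 r) psi (q - c).
  move=> [cq nUq]; split; first exact: circle_circle0.
  apply: contrapT => /(hidden_near r0 kr (circle_circle0 r0 cq)) h; apply: nUq.
  case: h => /(near_pt_le kh) /near_pt_translate h.
    by apply: Ua; move: h; rewrite -apsi subrK; apply: near_pt_le; rewrite ge_min lexx.
  by apply: Ub; move: h; rewrite -apsi -bc subrK; apply: near_pt_le; rewrite ge_min lexx orbT.
have [[V th] gE] := isom_plus_rigid c gisom.
have eps20 : 0 < eps / 2 by lra.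
have [l [lV lcov]] := small_translation r0 k0 V eps20.
pose ms := moves psi l ++ [:: (0, th)].
pose P t := run ms ((size ms)%:R * t).
have Pcont : continuous P.
  move=> t; apply: (@continuous_comp R R (plane R * R)%type
    (fun t => (size ms)%:R * t) (run ms)); last exact: run_continuous.
  by apply: cvgM; [exact: cvg_cst|exact: cvg_id].
have summ : \sum_(m <- ms) m = (V, th).
  rewrite /ms big_cat big_seq1 /= (_ : \sum_(m <- moves psi l) m = (V, 0)).
    by congr pair; rewrite /= ?addr0 ?add0r.
  rewrite -lV; elim: {lV lcov ms P Pcont} l => [|m l IH]; first by rewrite big_nil.
  rewrite /moves /= !big_cons -/(moves psi l) IH.
  by congr pair => /=; rewrite ?add0r //; ring.
exists (fun t => rigid c (P t)); split.
- apply: continuous_subspaceT.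
  exact: (continuous_curry_fun (rigid_continuous (c := c) Pcont)).
- by move=> t _; exact: rigid_isom_plus.
- apply/funext => z; rewrite /rigid /P mulr0 run_le0 // turn0 addr0.
  by rewrite addrC subrK.
- by rewrite gE /P mulr1 run_end summ.
apply: area_coverable; rewrite [eps]splitr.
have vcov := coverable_at_vertices l (fun e => coverable_circle0 r0) eps20.
apply: coverable_sub (coverable_translate c (coverableU lcov vcov)).
move=> _ [t _ [q /seen qE <-]].
have := visited_moves (run_visited ms ((size ms)%:R * t)) qE.
congr (_ _); by rewrite /rigid -/(P t) -[X in _ = X - c]addrA addrAC subrr add0r.
Qed.
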